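(* The rate-assignment algorithm described in the context (run on the given machines) is $O(K+\log n)$-competitive for bag-of-tasks scheduling on related machines, where $K$ is the number of distinct machine speeds and $n$ is the number of tasks.
   Context: Bag-of-tasks scheduling on related machines: $m$ machines with speeds $s_1\ge\dots\ge s_m>0$, $K$ distinct speed values, $S_k:=s_1+\dots+s_k$ ($S_k:=S_m$ for $k>m$). Each job $j$ has weight $w_j\ge0$ and a finite set $T(j)$ of tasks with processing requirements $p_v\ge0$; all jobs are released at time $0$. Tasks may be preempted and migrated; a task runs on at most one machine at a time, different tasks may run concurrently; a machine of speed $s$ running a task for $\varepsilon$ time does $s\varepsilon$ units of processing on it. A job completes at time $C_j$ when all its tasks have finished; the objective is $\sum_jw_jC_j$. Non-clairvoyance: $p_v$ is learned only when $v$ finishes. Competitive ratio: supremum over instances of (algorithm's objective)/(optimal offline objective on the same machines). Algorithm: at each time $t$, with $T^t(j)$ the alive tasks of job $j$, raise $\tau$ from $0$; each unfrozen alive task $v\in T^t(j)$ has tentative rate $L^t_v=\frac{w_j}{|T^t(j)|}\tau$; whenever a subset $V$ of alive tasks satisfies $\sum_{v\in V}L^t_v=S_{|V|}$, a maximal such set is frozen with its current rates; continue until all alive tasks are frozen. Each alive task is processed at its rate $L^t_v$. *)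

(* Defs.v *)
From mathcomp Require Import all_boot all_order all_algebra.
From mathcomp Require Import all_classical all_reals all_analysis.
Set Implicit Arguments.
Unset Strict Implicit.
Unset Printing Implicit Defensive.
Import Order.TTheory GRing.Theory Num.Theory.
Local Open Scope classical_set_scope.
Local Open Scope ring_scope.

(* Bag-of-tasks scheduling on related machines. Machines, tasks and jobs are
   numbered from 0; T(j) is the fibre of [job] over j, and it may be empty. *)
Record instance (R : realType) := Instance {
  nmach : nat;
  speed : 'I_nmach -> R;
  njobs : nat;
  ntasks : nat;
  job : 'I_ntasks -> 'I_njobs;
  weight : 'I_njobs -> R;
  proc : 'I_ntasks -> R;
  nmach_gt0 : (0 < nmach)%N;
  speed_gt0 : forall i, 0 < speed i;
  speed_noninc : forall i i' : 'I_nmach, (i <= i')%N -> speed i' <= speed i;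
  weight_ge0 : forall j, 0 <= weight j;
  proc_ge0 : forall v, 0 <= proc v }.

Definition nspeeds (R : realType) (I : instance R) : nat :=
  size (undup [seq speed i | i : 'I_(nmach I)]).

Definition prefix_speed (R : realType) (I : instance R) (k : nat) : R :=
  \sum_(i < nmach I | (i < k)%N) speed i.

(* Completion times live in \bar R. As 0 * +oo = 0, a job of weight 0 that
   never completes contributes 0. A job without tasks completes at time 0. *)
Definition objective (R : realType) (I : instance R)
    (C : 'I_(ntasks I) -> \bar R) : \bar R :=
  (\sum_(j < njobs I)
     (weight j)%:E * \big[maxe/0]_(v < ntasks I | job v == j) C v)%E.

(* Offline schedules. [sigma t i] is the task that machine i runs at time t,
   if any. Measurability in time allows arbitrary preemption and migration. *)
Definition schedule (R : realType) (I : instance R) :=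
  R -> 'I_(nmach I) -> option 'I_(ntasks I).

Definition feasible (R : realType) (I : instance R) (sigma : schedule I) :
    Prop :=
  (forall t i i' v, sigma t i = Some v -> sigma t i' = Some v -> i = i') /\
  (forall i v,
     measurable ([set t | sigma t i = Some v] : set (measurableTypeR R))).

Definition processed (R : realType) (I : instance R) (sigma : schedule I)
    (t : R) (v : 'I_(ntasks I)) : \bar R :=
  (\sum_(i < nmach I) (speed i)%:E *
     lebesgue_measure [set u : R | (0 <= u <= t)%R /\ sigma u i = Some v])%E.

Definition completion (R : realType) (I : instance R) (sigma : schedule I)
    (v : 'I_(ntasks I)) : \bar R :=
  ereal_inf [set t%:E | t in
    [set t : R | 0 <= t /\ ((proc v)%:E <= processed sigma t v)%E]].

Definition opt_cost (R : realType) (I : instance R) : \bar R :=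
  ereal_inf [set objective (completion sigma) | sigma in @feasible R I].

(* Rate assignment for a set A of alive tasks. [theta v = Some x] means that
   v was frozen at level tau = x, and [None] that v is unfrozen. *)
Definition unit_rate (R : realType) (I : instance R) (A : {set 'I_(ntasks I)})
    (v : 'I_(ntasks I)) : R :=
  weight (job v) / #|[pred v' in A | job v' == job v]|%:R.

Definition tentative_rate (R : realType) (I : instance R)
    (A : {set 'I_(ntasks I)}) (theta : 'I_(ntasks I) -> option R) (tau : R)
    (v : 'I_(ntasks I)) : R :=
  unit_rate A v * odflt tau (theta v).

Definition tight (R : realType) (I : instance R) (A : {set 'I_(ntasks I)})
    (theta : 'I_(ntasks I) -> option R) (tau : R) (V : {set 'I_(ntasks I)}) :
    bool :=
  (V \subset A) &&
  (\sum_(v in V) tentative_rate A theta tau v == prefix_speed I #|V|).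

(* The levels from tau0 on at which some tight set has an unfrozen task. *)
Definition freezing_levels (R : realType) (I : instance R)
    (A : {set 'I_(ntasks I)}) (theta : 'I_(ntasks I) -> option R) (tau0 : R) :
    set R :=
  [set tau | tau0 <= tau /\ exists V : {set 'I_(ntasks I)},
     tight A theta tau V /\ exists2 v, v \in V & theta v = None].

(* k freezing events, tau being raised from tau0. No sum of tentative rates
   exceeds S_|V| along the process and S is concave, so tight sets are closed
   under union: the maximal one is unique and is the largest. *)
Fixpoint raise (R : realType) (I : instance R) (A : {set 'I_(ntasks I)})
    (k : nat) (tau0 : R) (theta : 'I_(ntasks I) -> option R) :
    'I_(ntasks I) -> option R :=
  if k is k'.+1 then
    let E := freezing_levels A theta tau0 in
    if `[< E !=set0 >] then
      let tau := inf E in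
      let M := [arg max_(V > finset.set0 | tight A theta tau V) #|V|]%N in
      raise A k' tau
        (fun v => if theta v is Some x then Some x
                  else if v \in M then Some tau else None)
    else theta
  else theta.

(* Each event freezes a task, so #|A| events suffice. An alive task that never
   freezes has weight 0, hence rate 0 at every level. *)
Definition rate (R : realType) (I : instance R) (A : {set 'I_(ntasks I)})
    (v : 'I_(ntasks I)) : R :=
  if v \in A then tentative_rate A (raise A #|A| 0 (fun=> None)) 0 v else 0.

(* The run of the algorithm. The rates depend only on the set of alive tasks,
   so they are constant between consecutive completions; [alg_state I k] is
   the time of the k-th completion event (simultaneous completions being one
   event), with the remaining requirements at that time. If no task has
   positive rate, then the infimum is inf set0 = 0 and the state is
   stationary. *)
Definition alive (R : realType) (I : instance R) (r : 'I_(ntasks I) -> R) :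
    {set 'I_(ntasks I)} :=
  [set v | 0 < r v]%SET.

Definition alg_step (R : realType) (I : instance R)
    (st : R * ('I_(ntasks I) -> R)) : R * ('I_(ntasks I) -> R) :=
  let: (t, r) := st in
  let L := rate (alive r) in
  let delta := inf [set r v / L v | v in [set v | 0 < L v]] in
  (t + delta, fun v => r v - delta * L v).

Definition alg_state (R : realType) (I : instance R) (k : nat) :
    R * ('I_(ntasks I) -> R) :=
  iter k (@alg_step R I) (0, @proc R I).

Definition alg_completion (R : realType) (I : instance R)
    (v : 'I_(ntasks I)) : \bar R :=
  ereal_inf [set (alg_state I k).1%:E | k in
    [set k : nat | (alg_state I k).2 v <= 0]].

Definition alg_cost (R : realType) (I : instance R) : \bar R :=
  objective (@alg_completion R I).

(* Main.v *)
Require Import Defs.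
From mathcomp Require Import all_boot all_order all_algebra.
From mathcomp Require Import all_classical all_reals all_analysis.
From mathcomp Require Import zify ring lra.
Set Implicit Arguments.
Unset Strict Implicit.
Unset Printing Implicit Defensive.
Import Order.TTheory GRing.Theory Num.Theory.
Local Open Scope ring_scope.

(* The rates are proportionally fair: if u_v is the share of task v in the
   weight of its job, then sum_v u_v z_v / L_v <= sum_v u_v for all rates z with
   sum_(v in V) z_v <= S_|V|. Let H = 1 + ln n, and call a job j delayed if its
   completion time C_j exceeds 16 H times its offline completion time. At time t
   of the run, let z be the average offline rates over [0, t / 8H] of the tasks
   of the jobs that are complete offline by then, and integrate over t. The
   right-hand side becomes sum_j w_j C_j. On the left-hand side, a delayed job j
   takes part from time C_j / 2 on with z_v = 8 H p_v / t >= 8 H p_v / C_j.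
   Linearizing p / L >= 2 b - b^2 L / p at b = C_j / 2H leaves the error
   sum_v (1 / p_v) int L_v / |T^t(j)| dt, which is at most the harmonic sum H
   since |T^t(j)| is at least the rank of v in the order of completions. So j
   contributes at least 2 w_j C_j, and the delayed jobs account for at most half
   of the cost. This gives the factor 32 (1 + ln n). *)

(** * Machine speeds *)

Section Speeds.
Variables (R : realType) (I : instance R).

(** Speed 0 beyond the last machine makes these the nonincreasing increments of [prefix_speed] at
    every index. *)
Definition nth_speed (k : nat) : R :=
  if insub k is Some i then @speed R I i else 0.

Lemma nth_speed_ge0 k : 0 <= nth_speed k.
Proof. by rewrite /nth_speed; case: insub => // i; exact/ltW/speed_gt0. Qed.

Lemma nth_speed_noninc k l : (k <= l)%N -> nth_speed l <= nth_speed k.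
Proof.
move=> kl; rewrite {1}/nth_speed.
case: insubP => [i _ il|_]; last exact: nth_speed_ge0.
rewrite /nth_speed; case: insubP => [i' _ ik|]; first by apply: speed_noninc; move: kl; rewrite -ik -il.
by rewrite -leqNgt; have := ltn_ord i; move: il => /= il; lia.
Qed.

Lemma prefix_speed0 : prefix_speed I 0 = 0.
Proof. by rewrite /prefix_speed big1. Qed.

Lemma prefix_speedS k : prefix_speed I k.+1 = prefix_speed I k + nth_speed k.
Proof.
rewrite /prefix_speed /nth_speed; case: insubP => [i _ ik|km].
  rewrite (bigD1 i) /=; last by rewrite ik.
  rewrite addrC; congr (_ + _); apply: eq_bigl => i'.
  by rewrite -val_eqE /= ik; lia.
rewrite addr0; apply: eq_bigl => i; have := ltn_ord i; lia.
Qed.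

Lemma prefix_speed_gt0 k : (0 < k)%N -> 0 < prefix_speed I k.
Proof.
case: k => // k _; elim: k => [|k IH]; last first.
  by rewrite prefix_speedS ltr_wpDr// nth_speed_ge0.
rewrite prefix_speedS prefix_speed0 add0r /nth_speed.
case: insubP => [i _ _|]; first exact: speed_gt0.
by rewrite nmach_gt0.
Qed.

Lemma prefix_speed_le k l : (k <= l)%N -> prefix_speed I k <= prefix_speed I l.
Proof.
move=> kl; rewrite -(subnK kl); elim: (l - k)%N => // d IH.
by rewrite addSn prefix_speedS (le_trans IH) // lerDl nth_speed_ge0.
Qed.

Lemma prefix_speed_concave p q d : (q <= p)%N ->
  prefix_speed I (p + d) + prefix_speed I q <=
  prefix_speed I p + prefix_speed I (q + d).
Proof.
move=> qp; elim: d => [|d IH]; first by rewrite !addn0.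
rewrite !addnS !prefix_speedS.
have : nth_speed (p + d) <= nth_speed (q + d).
  by apply: nth_speed_noninc; rewrite leq_add2r.
lra.
Qed.

(** Concavity with [p] and [q] the sizes of [X] and [X :&: Y], and [d] that of [Y] minus [X]: then
    [p + d] is the size of the union. *)
Lemma prefix_speed_submod (T : finType) (X Y : {set T}) :
  prefix_speed I #|X :|: Y| + prefix_speed I #|X :&: Y| <=
  prefix_speed I #|X| + prefix_speed I #|Y|.
Proof.
have := @prefix_speed_concave #|X| #|X :&: Y| (#|Y| - #|X :&: Y|).
have := cardsUI X Y.
have := subset_leq_card (subsetIl X Y); have := subset_leq_card (subsetIr X Y).
move=> hY hX hUI /(_ hX); rewrite subnKC //.
suff -> : (#|X| + (#|Y| - #|X :&: Y|))%N = #|X :|: Y| by [].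
lia.
Qed.

(* Fractional knapsack: [nth_speed k] is the dual price of machine time. *)
Lemma prefix_speed_knapsack (m : 'I_(nmach I) -> R) (T : R) (k : nat) :
  0 <= T -> (forall i, 0 <= m i <= T) -> \sum_i m i <= k%:R * T ->
  \sum_i speed i * m i <= T * prefix_speed I k.
Proof.
move=> T0 mT sm.
(* For [i < k] the speed is at least the price and [m i - T <= 0]; for the other machines it is at
   most the price and [m i >= 0]. *)
have h i : speed i * m i <= (if (i < k)%N then T * speed i else 0) +
    nth_speed k * (m i - (if (i < k)%N then T else 0)).
  have si : speed i = nth_speed i by rewrite /nth_speed valK.
  have := mT i; rewrite si => /andP[m0 mT'].
  case: ltnP => ik.
    have := nth_speed_noninc (ltnW ik); nra.
  have := nth_speed_noninc ik; nra.
apply: le_trans (ler_sum _ (fun i _ => h i)) _.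
rewrite big_split /= -big_mkcond -!mulr_sumr sumrB.
rewrite -/(prefix_speed I k) gerDl.
rewrite -big_mkcond /= sumr_const.
(* For [k] beyond the last machine the price is 0; otherwise exactly [k] machines precede [k], and
   the bound on the total time makes the price term nonpositive. *)
rewrite {1}/nth_speed; case: insubP => [i _ ik|]; last by rewrite mul0r.
have -> : #|[pred i : 'I_(nmach I) | (i < k)%N]| = k.
  have km : (k <= nmach I)%N by rewrite -ik; exact/ltnW/ltn_ord.
  rewrite -sum1_card (big_ord_narrow km) /= sum1_card card_ord //.
rewrite -mulr_natl; apply: mulr_ge0_le0; first exact/ltW/speed_gt0.
lra.
Qed.

End Speeds.

(** * Proportional fairness of the rates *)

Section RateAssignment.
Variables (R : realType) (I : instance R) (A : {set 'I_(ntasks I)}).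
Implicit Types (V X Y : {set 'I_(ntasks I)}) (theta : 'I_(ntasks I) -> option R).
Implicit Types (z : 'I_(ntasks I) -> R) (tau : R).

(** The polymatroid constraints of the submodular function S_|V|, on sets of alive tasks. *)
Definition within_prefix_speeds z : Prop :=
  forall V, V \subset A -> \sum_(v in V) z v <= prefix_speed I #|V|.

Definition frozen theta : {set 'I_(ntasks I)} := [set v | isSome (theta v)]%SET.

Lemma unit_rate_ge0 v : 0 <= unit_rate A v.
Proof. by rewrite /unit_rate divr_ge0 ?weight_ge0. Qed.

Lemma unit_rate_gt0 v : v \in A -> 0 < weight (job v) -> 0 < unit_rate A v.
Proof.
move=> vA wv; rewrite /unit_rate divr_gt0 // ltr0n; apply/card_gt0P.
by exists v; rewrite inE vA eqxx.
Qed.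

(** This and [unfrozen_weight] are the constant term and the slope of the total tentative rate of
    [V] as an affine function of the level. *)
Definition frozen_rate theta V : R :=
  \sum_(v in V) (if theta v is Some x then unit_rate A v * x else 0).

Definition unfrozen_weight theta V : R :=
  \sum_(v in V) (if theta v is Some x then 0 else unit_rate A v).

Lemma sum_tentative_rate theta tau V :
  \sum_(v in V) tentative_rate A theta tau v =
  frozen_rate theta V + tau * unfrozen_weight theta V.
Proof.
rewrite /frozen_rate /unfrozen_weight mulr_sumr -big_split /=.
apply: eq_bigr => v _; rewrite /tentative_rate; case: (theta v) => [x|] /=.
  by rewrite mulr0 addr0.
by rewrite add0r mulrC.
Qed.

Lemma unfrozen_weight_ge0 theta V : 0 <= unfrozen_weight theta V.
Proof.
apply: sumr_ge0 => v _; case: (theta v) => // ; exact: unit_rate_ge0.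
Qed.

Lemma unfrozen_weight_neq0 theta V : unfrozen_weight theta V != 0 ->
  exists2 v, v \in V & theta v = None.
Proof.
move=> h; apply: contrapT => nex; move/negP: h; apply.
rewrite /unfrozen_weight big1 // => v vV.
by case E: (theta v) => //; exfalso; apply: nex; exists v.
Qed.

(** The infimum is attained because each of the finitely many sets [V] has a first level at which it
    is tight, so a minimum over sets suffices. *)
Lemma freezing_levels_min theta tau0 : (freezing_levels A theta tau0 !=set0)%classic ->
  freezing_levels A theta tau0 (inf (freezing_levels A theta tau0)) /\
  (forall tau, freezing_levels A theta tau0 tau ->
     inf (freezing_levels A theta tau0) <= tau).
Proof.
set E := freezing_levels A theta tau0.
suff h : (E !=set0)%classic -> exists2 e, E e & forall tau, E tau -> e <= tau.
  move=> E0; have [e Ee le] := h E0.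
  suff -> : inf E = e by [].
  apply/eqP; rewrite eq_le; apply/andP; split.
    by apply: ge_inf Ee; exists e.
  by apply: lb_le_inf.
(* With slope 0, tightness does not depend on the level, so [tau0] is the first candidate; otherwise
   the affine equation has a unique solution. *)
pose lev V := if unfrozen_weight theta V == 0 then tau0 else
  (prefix_speed I #|V| - frozen_rate theta V) / unfrozen_weight theta V.
pose P V := [&& tau0 <= lev V, tight A theta (lev V) V &
  [exists v in V, theta v == None]].
have levP tau V : tau0 <= tau -> tight A theta tau V ->
    (exists2 v, v \in V & theta v = None) -> P V /\ lev V <= tau.
  move=> tau0tau tV [v vV v0].
  have ex : [exists v in V, theta v == None].
    by apply/existsP; exists v; rewrite vV v0 eqxx.
  suff [h1 [h2 h3]] : tau0 <= lev V /\ tight A theta (lev V) V /\ lev V <= tau.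
    by split=> //; rewrite /P h1 h2 ex.
  move: tV; rewrite /tight !sum_tentative_rate => /andP[-> /eqP eV] /=.
  rewrite /lev; case: eqVneq => [w0|w0]; first by rewrite -eV w0 !mulr0 eqxx.
  have <- : tau = (prefix_speed I #|V| - frozen_rate theta V) /
      unfrozen_weight theta V.
    by rewrite -eV; field.
  by rewrite eV.
move=> [tau1 [le1 [V1 [tV1 ex1]]]].
have [PV1 _] := levP _ _ le1 tV1 ex1.
case: (Order.TotalTheory.arg_minP lev PV1) => V /and3P[l1 l2 /existsP[v /andP[vV /eqP v0]]] min.
exists (lev V); first by split=> //; exists V; split=> //; exists v.
move=> tau [le [V' [tV' ex']]].
have [PV' lV'] := levP _ _ le tV' ex'.
exact: le_trans (min _ PV') lV'.
Qed.

Lemma sum_setUI z X Y : \sum_(v in X :|: Y) z v + \sum_(v in X :&: Y) z v =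
  \sum_(v in X) z v + \sum_(v in Y) z v.
Proof.
rewrite (big_setID Y) /= [in X in _ = X + _](big_setID Y) /=.
rewrite finset.setDUl finset.setDv finset.setU0.
rewrite (finset.setIidPr (finset.subsetUr X Y)); ring.
Qed.

(** Uncrossing: union and intersection together carry S_|X| + S_|Y|, which by submodularity is at
    least the sum of their own bounds, so neither bound is slack. *)
Lemma tight_setU theta tau X Y :
  within_prefix_speeds (tentative_rate A theta tau) ->
  tight A theta tau X -> tight A theta tau Y -> tight A theta tau (X :|: Y).
Proof.
move=> feas /andP[XA /eqP eX] /andP[YA /eqP eY]; apply/andP; split.
  by rewrite finset.subUset XA YA.
rewrite eq_le feas ?finset.subUset ?XA ?YA //=.
have := feas (X :&: Y) (fintype.subset_trans (finset.subsetIl _ _) XA).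
have := prefix_speed_submod I X Y.
have := sum_setUI (tentative_rate A theta tau) X Y.
rewrite eX eY; lra.
Qed.

(* The last clause is Abel summation over the freezing events: the frozen set
   is tight at each event and [1 / tau] only decreases. *)
Definition raise_invariant tau theta : Prop :=
  [/\ 0 <= tau,
      forall v x, theta v = Some x -> v \in A /\ 0 < x <= tau,
      \sum_(v in frozen theta) tentative_rate A theta tau v =
        prefix_speed I #|frozen theta|,
      within_prefix_speeds (tentative_rate A theta tau) &
      forall z, within_prefix_speeds z ->
        (\sum_(v in frozen theta) (tentative_rate A theta tau v - z v)) / tau <=
        \sum_(v in frozen theta)
          (tentative_rate A theta tau v - z v) / odflt tau (theta v)].

Lemma raise_invariant0 : raise_invariant 0 (fun=> None).
Proof.
have f0 : frozen (fun=> None) = finset.set0.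
  by apply/setP => v; rewrite !inE.
split=> //.
- by rewrite f0 big_set0 cards0 prefix_speed0.
- move=> V VA; rewrite big1 => [|v _]; last by rewrite /tentative_rate /= mulr0.
  case: (posnP #|V|) => [->|/prefix_speed_gt0/ltW //]; by rewrite prefix_speed0.
- by move=> z _; rewrite f0 !big_set0 mul0r.
Qed.

Lemma frozen_subset tau theta : raise_invariant tau theta -> frozen theta \subset A.
Proof.
case=> _ h _ _ _; apply/fintype.subsetP => v; rewrite inE.
by case E: (theta v) => [x|] // _; have [] := h _ _ E.
Qed.

(** A set violated at [e] but not at [tau] has positive slope, hence an unfrozen task, and was tight
    at a level in between: a freezing level below [e]. *)
Lemma within_prefix_speeds_raise theta tau e :
  within_prefix_speeds (tentative_rate A theta tau) -> tau <= e ->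
  (forall tau', freezing_levels A theta tau tau' -> e <= tau') ->
  within_prefix_speeds (tentative_rate A theta e).
Proof.
move=> feas te emin V VA; rewrite leNgt; apply/negP => lt.
have := feas V VA; move: lt; rewrite !sum_tentative_rate => lt le.
set a := frozen_rate _ _ in lt le; set b := unfrozen_weight _ _ in lt le.
have b0 : 0 <= b by exact: unfrozen_weight_ge0.
have bn0 : b != 0 by apply: contraTneq lt => b0'; move: le; rewrite b0' -leNgt; lra.
have bp : 0 < b by rewrite lt_def bn0.
set S := prefix_speed _ _ in lt le.
have : e <= (S - a) / b.
  apply: emin; split; first by rewrite ler_pdivlMr //; lra.
  exists V; split; last exact: unfrozen_weight_neq0.
  rewrite /tight VA sum_tentative_rate -/a -/b -/S /=.
  by apply/eqP; field.
by rewrite ler_pdivlMr //; lra.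
Qed.

Lemma raise_invariant_step tau theta :
  let E := freezing_levels A theta tau in
  let M := [arg max_(V > finset.set0 | tight A theta (inf E) V) #|V|]%N in
  let theta' := fun v => if theta v is Some x then Some x
                  else if v \in M then Some (inf E) else None in
  raise_invariant tau theta -> (E !=set0)%classic ->
  raise_invariant (inf E) theta' /\ (#|frozen theta| < #|frozen theta'|)%N.
Proof.
move=> E M theta' inv E0; have FA := frozen_subset inv.
case: inv => tau0 lev tF feas abel.
have [] := freezing_levels_min E0; rewrite -/E; set e := inf E.
move=> [te [V [tV [v0 v0V v0N]]]] emin.
have feas_e := within_prefix_speeds_raise feas te emin.
have tent_F v : v \in frozen theta ->
    tentative_rate A theta e v = tentative_rate A theta tau v.
  by rewrite inE /tentative_rate; case: (theta v).
have tF_e : tight A theta e (frozen theta).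
  by rewrite /tight FA (eq_bigr _ tent_F) tF eqxx.
(* The default value [set0] of the arg max is itself tight, so the maximum is a genuine one. *)
have [tM maxM] : tight A theta e M /\
    forall W, tight A theta e W -> (#|W| <= #|M|)%N.
  rewrite /M -/E -/e; case: arg_maxnP => [|W tW maxW]; last by split.
  by rewrite /tight finset.sub0set big_set0 cards0 prefix_speed0 eqxx.
have sM W : tight A theta e W -> W \subset M.
  move=> tW; have := maxM _ (tight_setU feas_e tW tM) => le.
  have /eqP <- : W :|: M == M.
    by rewrite eq_sym eqEcard finset.subsetUr.
  exact: finset.subsetUl.
have FM := sM _ tF_e; have VM := sM _ tV.
have v0M := fintype.subsetP VM _ v0V.
have v0F : v0 \notin frozen theta by rewrite inE v0N.
have Ftheta' : frozen theta' = M.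
  apply/setP => v; rewrite !inE /theta'.
  case Ev: (theta v) => [x|] /=; last by case: ifP.
  by apply/esym/(fintype.subsetP FM); rewrite inE Ev.
have tent' v : tentative_rate A theta' e v = tentative_rate A theta e v.
  by rewrite /tentative_rate /theta'; case: (theta v) => //=; case: ifP.
(* At level 0 no task could have been frozen earlier, so all rates would vanish, although the
   nonempty set [V] is tight. *)
have e0 : 0 < e.
  rewrite lt_def (le_trans tau0 te) andbT; apply/eqP => e0.
  case/andP: tV => VA /eqP; rewrite big1 => [/esym /eqP|v _].
    by rewrite gt_eqF // prefix_speed_gt0 //; apply/card_gt0P; exists v0.
  rewrite /tentative_rate; case Ev: (theta v) => [x|] /=; last by rewrite e0 mulr0.
  have [_ /andP[x0 xt]] := lev _ _ Ev.
  by have := lt_le_trans x0 (le_trans xt te); rewrite e0 ltxx.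
split; last first.
  by rewrite Ftheta'; apply/proper_card/properP; split => //; exists v0.
split; first exact: ltW.
- move=> v x; rewrite /theta'; case Ev: (theta v) => [y|].
    move=> [<-]; have [vA /andP[y0 yt]] := lev _ _ Ev.
    by rewrite vA y0 (le_trans yt te).
  case: ifP => // vM [<-]; rewrite e0 lexx; split=> //.
  by case/andP: tM => /fintype.subsetP /(_ _ vM).
- rewrite Ftheta' (eq_bigr _ (fun v _ => tent' v)).
  by case/andP: tM => _ /eqP.
- by move=> W WA; rewrite (eq_bigr _ (fun v _ => tent' v)); exact: feas_e.
move=> z zf; rewrite Ftheta'.
rewrite (eq_bigr (fun v => tentative_rate A theta e v - z v)) => [|v _]; last first.
  by rewrite tent'.
rewrite [leRHS](eq_bigr (fun v => (tentative_rate A theta e v - z v) /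
    odflt e (theta' v))) => [|v _]; last by rewrite tent'.
(* Newly frozen tasks have divisor [e] on both sides. Over the old ones the sum of rate minus [z] is
   nonnegative by tightness, so replacing [1 / tau] by the smaller [1 / e] only lowers the left-hand
   side. *)
rewrite (big_setID (frozen theta)) [leRHS](big_setID (frozen theta)) /=.
rewrite (finset.setIidPr FM) mulrDl; apply: lerD; last first.
  rewrite mulr_suml; apply: ler_sum => v; rewrite !inE => /andP[vF vM].
  by rewrite /theta'; case: (theta v) vF => //= _; rewrite vM.
rewrite (eq_bigr (fun v => tentative_rate A theta tau v - z v)) => [|v vF]; last first.
  by rewrite tent_F.
rewrite [leRHS](eq_bigr (fun v => (tentative_rate A theta tau v - z v) /
    odflt tau (theta v))) => [|v vF]; last first.
  by rewrite tent_F // /theta'; move: vF; rewrite inE; case: (theta v).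
apply: le_trans (abel _ zf).
have [F0|[v vF]] := set_0Vmem (frozen theta); first by rewrite F0 !big_set0 !mul0r.
have tp : 0 < tau.
  move: vF; rewrite inE; case Ev: (theta v) => [x|] // _.
  by have [_ /andP[x0 xt]] := lev _ _ Ev; exact: lt_le_trans xt.
apply: ler_wpM2l; last by rewrite lef_pV2.
by rewrite sumrB tF subr_ge0; exact: zf.
Qed.

Lemma raise_invariant_raise k tau theta : raise_invariant tau theta ->
  exists2 tau', raise_invariant tau' (raise A k tau theta) &
    (k + #|frozen theta| <= #|frozen (raise A k tau theta)|)%N \/
    ~ (freezing_levels A (raise A k tau theta) tau' !=set0)%classic.
Proof.
elim: k tau theta => [|k IH] tau theta inv; first by exists tau => //; left.
rewrite /=; case: asboolP => [E0|E0]; last by exists tau => //; right.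
have [inv' lt] := raise_invariant_step inv E0.
have [tau' inv'' or] := IH _ _ inv'.
exists tau' => //; case: or => [le|]; [left|by right].
by apply: leq_trans le; rewrite addSnnS leq_add2l.
Qed.

(** If the process stopped early with [v] unfrozen, the singleton of [v] would still become tight,
    at level S_1 divided by the unit rate. *)
Lemma raise_frozen v : v \in A -> 0 < unit_rate A v ->
  isSome (raise A #|A| 0 (fun=> None) v).
Proof.
move=> vA uv; have [tau inv or] := raise_invariant_raise #|A| raise_invariant0.
set theta := raise _ _ _ _ in inv or *.
have FA := frozen_subset inv.
case: or => [le|nE].
  have /eqP FE : frozen theta == A.
    by rewrite eqEcard FA (leq_trans _ le) // leq_addr.
  by move: vA; rewrite -[in v \in A]FE inE.
case Ev: (theta v) => [//|]; exfalso; apply: nE.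
case: inv => _ _ _ feas _.
have := feas [set v]%SET; rewrite finset.sub1set => /(_ vA).
rewrite big_set1 cards1 /tentative_rate Ev /= => le.
exists (prefix_speed I 1 / unit_rate A v); split; first by rewrite ler_pdivlMr // mulrC.
exists [set v]%SET; split; last by exists v; rewrite ?inE.
rewrite /tight finset.sub1set vA big_set1 cards1 /tentative_rate Ev /=.
by rewrite mulrC divfK ?lt0r_neq0 /=.
Qed.

Lemma rate_notin v : v \notin A -> rate A v = 0.
Proof. by rewrite /rate => /negbTE ->. Qed.

Lemma rate_gt0 v : v \in A -> 0 < weight (job v) -> 0 < rate A v.
Proof.
move=> vA wv; have uv := unit_rate_gt0 vA wv.
have := raise_frozen vA uv.
have [tau [_ lev _ _ _] _] := raise_invariant_raise #|A| raise_invariant0.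
rewrite /rate vA /tentative_rate; case Ev: (raise _ _ _ _ v) => [x|] // _.
by have [_ /andP[x0 _]] := lev _ _ Ev; rewrite mulr_gt0.
Qed.

Lemma rate_ge0 v : 0 <= rate A v.
Proof.
rewrite /rate; case: ifP => // vA.
have [tau [_ lev _ _ _] _] := raise_invariant_raise #|A| raise_invariant0.
rewrite /tentative_rate; case Ev: (raise _ _ _ _ v) => [x|] /=; last by rewrite mulr0.
have [_ /andP[x0 _]] := lev _ _ Ev; rewrite mulr_ge0 ?unit_rate_ge0 //; exact: ltW.
Qed.

(** This is the first-order optimality condition for maximizing the sum of u_v ln L_v. It follows
    from the last clause of [raise_invariant], whose left-hand side is nonnegative, because L_v /
    theta_v = u_v on frozen tasks. *)
Lemma proportional_fairness z : (forall v, 0 <= z v) -> within_prefix_speeds z ->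
  \sum_(v in A) z v * (unit_rate A v / rate A v) <= \sum_(v in A) unit_rate A v.
Proof.
move=> z0 zf; have [tau inv _] := raise_invariant_raise #|A| raise_invariant0.
have FA := frozen_subset inv; have frz := raise_frozen.
have rateE v : v \in A -> rate A v =
    unit_rate A v * odflt 0 (raise A #|A| 0 (fun=> None) v).
  by rewrite /rate => ->.
set theta := raise _ _ _ _ in inv FA frz rateE.
case: inv => tau0 lev tF _ /(_ _ zf) abel.
have abel0 : 0 <= \sum_(v in frozen theta)
    (tentative_rate A theta tau v - z v) / odflt tau (theta v).
  apply: le_trans abel; rewrite divr_ge0 // sumrB tF subr_ge0; exact: zf.
apply: (@le_trans _ _ (\sum_(v in frozen theta) unit_rate A v)); last first.
  rewrite [leRHS](big_setID (frozen theta)) /= (finset.setIidPr FA) lerDl.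
  by apply: sumr_ge0 => v _; exact: unit_rate_ge0.
apply: (@le_trans _ _ (\sum_(v in frozen theta) z v / odflt tau (theta v))).
  rewrite (big_setID (frozen theta)) /= (finset.setIidPr FA).
  rewrite [X in _ + X]big1 ?addr0 => [|v]; last first.
    rewrite !inE => /andP[vF vA]; have [uv|uv] := ltP 0 (unit_rate A v).
      by move: vF; rewrite frz.
    suff -> : unit_rate A v = 0 by rewrite mul0r mulr0.
    by apply/eqP; rewrite eq_le uv unit_rate_ge0.
  apply: ler_sum => v vF; rewrite rateE ?(fintype.subsetP FA) //.
  move: vF; rewrite inE; case Ev: (theta v) => [x|] //= _.
  have [_ /andP[x0 _]] := lev _ _ Ev.
  (* A task of unit rate 0 contributes 0 on the left, whence an inequality rather than an
     equality. *)
  have [->|u0] := eqVneq (unit_rate A v) 0; first by rewrite mul0r mulr0 divr_ge0 // ltW.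
  by rewrite invfM mulVKf.
rewrite -subr_ge0 -sumrB; apply: le_trans abel0 _; apply: ler_sum => v.
rewrite inE /tentative_rate; case Ev: (theta v) => [x|] //= _.
have [_ /andP[x0 _]] := lev _ _ Ev.
by rewrite mulrBl mulfK // gt_eqF.
Qed.

End RateAssignment.

(** * Offline schedules *)

Section Offline.
Local Open Scope classical_set_scope.

Lemma sum_lebesgue_measure_le (R : realType) (n : nat) (P : {pred 'I_n})
    (F : 'I_n -> set (measurableTypeR R)) (T : R) : 0 <= T ->
  (forall j, measurable (F j)) -> trivIset [set: 'I_n] F ->
  (forall j, F j `<=` `[0, T]) ->
  (\sum_(j < n | P j) lebesgue_measure (F j) <= T%:E)%E.
Proof.
move=> T0 mF tF sF; rewrite -measure_bigsetU_ord //.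
have <- : lebesgue_measure (`[0, T]%classic : set (measurableTypeR R)) = T%:E.
  rewrite lebesgue_measure_itv /= lte_fin.
  by case: ltP => // [_|T0']; [rewrite sube0|congr _%:E; lra].
apply: le_measure; rewrite ?inE //.
  by apply: bigsetU_measurable => j _.
apply: (big_ind (fun X => X `<=` `[0, T])) => [|X Y XT YT|j _]; last exact: sF.
  exact: classical_sets.sub0set.
by rewrite classical_sets.subUset.
Qed.

Variables (R : realType) (I : instance R) (sigma : schedule I).
Hypothesis sigma_feasible : feasible sigma.

Let run (T : R) i v : set (measurableTypeR R) :=
  [set u : R | (0 <= u <= T)%R /\ sigma u i = Some v].

Let run_itv T i v : run T i v `<=` `[0, T].
Proof. by move=> u [uT _]; rewrite /= in_itv. Qed.

Let measurable_run T i v : measurable (run T i v).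
Proof.
rewrite (_ : run T i v = (`[0, T]%classic : set (measurableTypeR R)) `&`
  [set t | sigma t i = Some v]); last by apply/seteqP; split => u /=; rewrite in_itv.
by apply: measurableI => //; case: sigma_feasible => _.
Qed.

Let run_trivI_machine T v : trivIset setT (fun i => run T i v).
Proof.
move=> i i' _ _ [u [[_ h] [_ h']]]; case: sigma_feasible => inj _.
exact: inj h h'.
Qed.

Let run_trivI_task T i : trivIset setT (run T i).
Proof. by move=> v v' _ _ [u [[_ h] [_ h']]]; move: h'; rewrite h => -[]. Qed.

Lemma processed_le (v : 'I_(ntasks I)) (t T : R) : t <= T ->
  (processed sigma t v <= processed sigma T v)%E.
Proof.
move=> tT; apply: lee_sum => i _; apply: lee_wpmul2l.
  by rewrite lee_fin ltW ?speed_gt0.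
apply: le_measure; rewrite ?inE; [exact: measurable_run|exact: measurable_run|].
by move=> u [/andP[u0 ut] h]; split=> //; rewrite u0 (le_trans ut).
Qed.

(** The strict bound extracts from the infimum an actual time before [T] at which the work is
    done. *)
Lemma proc_le_processed (v : 'I_(ntasks I)) (T : R) :
  (completion sigma v < T%:E)%E -> ((proc v)%:E <= processed sigma T v)%E.
Proof.
move=> /ereal_inf_lt[_ [t [t0 pt] <-]]; rewrite lte_fin => tT.
exact: le_trans pt (processed_le _ (ltW tT)).
Qed.

(** Knapsack on the time each machine spends on [V] up to [T]: no machine exceeds [T], and no task
    uses more than [T] in total over the machines. *)
Lemma sum_proc_le (V : {set 'I_(ntasks I)}) (T : R) : 0 <= T ->
  (forall v, v \in V -> (completion sigma v < T%:E)%E) ->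
  \sum_(v in V) proc v <= T * prefix_speed I #|V|.
Proof.
move=> T0 cV; pose m i v := fine (lebesgue_measure (run T i v)).
have mE i v : lebesgue_measure (run T i v) = (m i v)%:E.
  rewrite fineK // ge0_fin_numE //.
  have := @sum_lebesgue_measure_le R _ (pred1 v) (run T i) T T0
    (@measurable_run T i) (@run_trivI_task T i) (@run_itv T i).
  by rewrite big_pred1_eq => /le_lt_trans; apply; rewrite ltry.
have m0 i v : 0 <= m i v by rewrite fine_ge0.
have machine i : \sum_(v in V) m i v <= T.
  rewrite -lee_fin -sumEFin (eq_bigr _ (fun v _ => esym (mE i v))).
  exact: sum_lebesgue_measure_le.
have task v : \sum_i m i v <= T.
  rewrite -lee_fin -sumEFin (eq_bigr _ (fun i _ => esym (mE i v))).
  exact: (@sum_lebesgue_measure_le _ _ predT (fun i => run T i v)).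
apply: (@le_trans _ _ (\sum_i speed i * \sum_(v in V) m i v)).
  under [leRHS]eq_bigr do rewrite mulr_sumr.
  rewrite exchange_big /=; apply: ler_sum => v vV.
  rewrite -lee_fin -sumEFin; have := proc_le_processed (cV v vV).
  rewrite /processed => /le_trans; apply; apply: lee_sum => i _.
  by rewrite -/(run T i v) mE.
apply: prefix_speed_knapsack => // [i|].
  by rewrite machine sumr_ge0.
rewrite exchange_big /= (le_trans (ler_sum _ (fun v _ => task v))) //.
by rewrite sumr_const mulr_natl.
Qed.

End Offline.

(** * The run of the algorithm *)

Lemma harmonic_le_ln (R : realType) (n : nat) :
  \sum_(i < n) i.+1%:R^-1 <= 1 + ln n%:R :> R.
Proof.
elim: n => [|n IH]; first by rewrite big_ord0 ln0 // addr0.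
rewrite big_ord_recr /=; case: (posnP n) IH => [->|n0] IH.
  by rewrite big_ord0 add0r invr1 ln1 addr0.
have n1 : 0 < n.+1%:R :> R by rewrite ltr0n.
(* ln (1 + x) <= x at x = -1/(n+1), where 1 + x = n/(n+1). *)
have := @le_ln1Dx R (- n.+1%:R^-1).
rewrite ltrN2 invf_lt1 // ltr1n ltnS n0 => /(_ isT).
have -> : 1 - n.+1%:R^-1 = n%:R / n.+1%:R :> R.
  by rewrite -natr1 in n1 *; field; exact: lt0r_neq0.
rewrite ln_div ?posrE ?ltr0n // => h.
by move: h IH; move: (ln n.+1%:R) (n.+1%:R^-1) => a b; lra.
Qed.

(** Remove an element with the least [d]: its term is 1/|P|, and the other counts can only shrink,
    so their reciprocals only grow. *)
Lemma sum_inv_rank_le (R : realType) (T : finType) (d : T -> nat) (P : {set T}) :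
  \sum_(v in P) (#|[set w in P | (d v <= d w)%N]%SET|%:R)^-1 <=
  1 + ln #|P|%:R :> R.
Proof.
apply: le_trans (harmonic_le_ln R #|P|).
move cP: #|P| => n; elim: n P cP => [|n IH] P cP.
  by rewrite (cards0_eq cP) big_set0 big_ord0.
have /card_gt0P[v1 v1P] : (0 < #|P|)%N by rewrite cP.
case: (@arg_minnP _ v1 (mem P) d v1P) => v0 v0M min; have v0P : v0 \in P by [].
rewrite big_ord_recr /= addrC (big_setD1 v0) //=; apply: lerD.
  suff -> : [set w in P | (d v0 <= d w)%N]%SET = P by rewrite cP.
  by apply/setP => w; rewrite !inE; case wP: (w \in P) => //=; rewrite min.
have cP' : #|P :\ v0| = n by have := cardsD1 v0 P; rewrite v0P cP; lia.
apply: le_trans (IH _ cP'); apply: ler_sum => v vP.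
rewrite lef_pV2 ?posrE ?ltr0n; first last.
- by apply/card_gt0P; exists v; rewrite inE vP leqnn.
- by apply/card_gt0P; exists v; move: vP; rewrite !inE => /andP[_ ->]; rewrite leqnn.
rewrite ler_nat; apply/subset_leq_card/fintype.subsetP => w.
by rewrite !inE => /andP[/andP[_ ->]].
Qed.

Section Run.
Variables (R : realType) (I : instance R).
Implicit Types (v : 'I_(ntasks I)) (j : 'I_(njobs I)).

Definition run_time k : R := (alg_state I k).1.
Definition remaining k : 'I_(ntasks I) -> R := (alg_state I k).2.
Definition alive_at k : {set 'I_(ntasks I)} := alive (remaining k).
Definition rate_at k : 'I_(ntasks I) -> R := rate (alive_at k).
Definition phase_length k : R :=
  inf [set remaining k v / rate_at k v | v in [set v | 0 < rate_at k v]]%classic.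
Definition job_alive k j : bool := [exists v in alive_at k, job v == j].
Definition num_alive k j : nat := #|[pred v in alive_at k | job v == j]|.
(** A sum over phases, so that sums over jobs and over time can be exchanged. A job of positive
    weight is no longer alive after [ntasks I] phases, so for it none is missed. *)
Definition job_time j : R :=
  \sum_(k < ntasks I | job_alive k j) phase_length k.

Lemma run_timeS k : run_time k.+1 = run_time k + phase_length k.
Proof.
by rewrite /phase_length /rate_at /alive_at /run_time /remaining /alg_state iterS
  /alg_step; case: (iter _ _ _).
Qed.

Lemma remainingS k v :
  remaining k.+1 v = remaining k v - phase_length k * rate_at k v.
Proof.
by rewrite /phase_length /rate_at /alive_at /remaining /alg_state iterS
  /alg_step; case: (iter _ _ _).
Qed.

Lemma mem_alive_at k v : (v \in alive_at k) = (0 < remaining k v).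
Proof. by rewrite inE. Qed.

Lemma rate_at_ge0 k v : 0 <= rate_at k v.
Proof. exact: rate_ge0. Qed.

Lemma rate_at_alive k v : 0 < rate_at k v -> v \in alive_at k.
Proof. by apply: contraTT => /rate_notin; rewrite /rate_at => ->; rewrite ltxx. Qed.

Lemma phase_length_ge0 k : 0 <= phase_length k.
Proof.
rewrite /phase_length; set E := (X in inf X).
have [->|E0] := eqVneq E set0; first by rewrite inf0.
apply: lb_le_inf; first exact/set0P.
move=> _ [v Lv <-]; rewrite divr_ge0 ?rate_at_ge0 //.
by have := rate_at_alive Lv; rewrite mem_alive_at => /ltW.
Qed.

Lemma phase_length_le k v : 0 < rate_at k v ->
  phase_length k <= remaining k v / rate_at k v.
Proof.
move=> Lv; apply: ge_inf; last by exists v.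
exists 0 => _ [w Lw <-]; rewrite divr_ge0 ?rate_at_ge0 //.
by have := rate_at_alive Lw; rewrite mem_alive_at => /ltW.
Qed.

Lemma remaining_ge0 k v : 0 <= remaining k v.
Proof.
elim: k => [|k IH]; first exact: proc_ge0.
rewrite remainingS subr_ge0; have [Lv|Lv] := ltP 0 (rate_at k v).
  by rewrite -ler_pdivlMr //; exact: phase_length_le.
suff -> : rate_at k v = 0 by rewrite mulr0.
by apply/eqP; rewrite eq_le Lv rate_at_ge0.
Qed.

Lemma alive_at_noninc k l : (k <= l)%N -> alive_at l \subset alive_at k.
Proof.
move=> kl; apply/fintype.subsetP => v; rewrite !mem_alive_at => /lt_le_trans; apply.
elim: l kl => [|l IH]; first by rewrite leqn0 => /eqP ->.
rewrite leq_eqVlt => /predU1P[<- //|/IH]; apply: le_trans.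
by rewrite remainingS gerBl mulr_ge0 ?phase_length_ge0 ?rate_at_ge0.
Qed.

Lemma job_alive_noninc k l j : (k <= l)%N -> job_alive l j -> job_alive k j.
Proof.
move=> kl /existsP[v /andP[vl vj]]; apply/existsP; exists v.
by rewrite vj (fintype.subsetP (alive_at_noninc kl)).
Qed.

(** The task minimizing remaining work over rate attains the phase length and finishes at the end of
    the phase. *)
Lemma alive_at_proper k v : 0 < rate_at k v ->
  (#|alive_at k.+1| < #|alive_at k|)%N.
Proof.
move=> Lv.
case: (Order.TotalTheory.arg_minP (fun w => remaining k w / rate_at k w)
  (P := fun w => 0 < rate_at k w) Lv) => w Lw min.
apply/proper_card/properP; split; first exact: alive_at_noninc.
exists w; first exact: rate_at_alive.
rewrite mem_alive_at remainingS -leNgt subr_le0 -ler_pdivrMr //.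
apply: lb_le_inf; first by exists (remaining k w / rate_at k w); exists w.
by move=> _ [w' Lw' <-]; exact: min.
Qed.

Lemma card_alive_at k v : v \in alive_at k -> 0 < weight (job v) ->
  (#|alive_at k| + k <= ntasks I)%N.
Proof.
move=> vk wv; elim: k vk => [|k IH] vk.
  by rewrite addn0 (leq_trans (max_card _)) // card_ord.
have vk' := fintype.subsetP (alive_at_noninc (leqnSn k)) _ vk.
have := alive_at_proper (rate_gt0 vk' wv); have := IH vk'; lia.
Qed.

Lemma job_alive_end j : 0 < weight j -> ~~ job_alive (ntasks I) j.
Proof.
move=> wj; apply/existsP => -[v /andP[vn /eqP vj]].
have := card_alive_at vn; rewrite vj => /(_ wj).
have : (0 < #|alive_at (ntasks I)|)%N by apply/card_gt0P; exists v.
lia.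
Qed.

Lemma run_time_sum k : run_time k = \sum_(i < k) phase_length i.
Proof.
elim: k => [|k IH]; first by rewrite big_ord0.
by rewrite run_timeS IH big_ord_recr.
Qed.

Lemma run_time_le_job_time k j : (k < ntasks I)%N -> job_alive k j ->
  run_time k.+1 <= job_time j.
Proof.
move=> kn kj; rewrite run_time_sum (big_ord_widen _ phase_length kn) /job_time.
rewrite big_mkcond [leRHS]big_mkcond; apply: ler_sum => i _.
case: ltnP => [ik|_]; last by case: ifP => // _; exact: phase_length_ge0.
by rewrite (job_alive_noninc _ kj).
Qed.

Lemma alg_completion_le v : 0 < weight (job v) ->
  (alg_completion v <= (job_time (job v))%:E)%E.
Proof.
move=> wv; have ex : exists k, ~~ job_alive k (job v).
  by exists (ntasks I); exact: job_alive_end.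
case: (ex_minnP ex) => k kv min.
have kn : (k <= ntasks I)%N by apply/min/job_alive_end.
have -> : job_time (job v) = run_time k.
  rewrite run_time_sum (big_ord_widen _ phase_length kn); apply: eq_bigl => i.
  case: ltnP => ik; last by apply: contraNF kv; exact: job_alive_noninc.
  by apply: contraTT ik => /min; rewrite -leqNgt.
apply: ereal_inf_lbound; exists k => //=.
rewrite -/(remaining k) leNgt -mem_alive_at; apply: contra kv => vk.
by apply/existsP; exists v; rewrite vk eqxx.
Qed.

Lemma sum_work_le N v : \sum_(k < N) phase_length k * rate_at k v <= proc v.
Proof.
suff : \sum_(k < N) phase_length k * rate_at k v = proc v - remaining N v.
  by move=> ->; rewrite gerBl remaining_ge0.
elim: N => [|N IH]; first by rewrite big_ord0 subrr.
by rewrite big_ord_recr /= IH remainingS; ring.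
Qed.

Lemma sum_early_phases_le N (x : R) : 0 <= x ->
  \sum_(k < N | run_time k.+1 < x) phase_length k <= x.
Proof.
(* The bound by [run_time N] strengthens the induction: a newly counted phase ends before [x]. *)
move=> x0; suff : \sum_(k < N | run_time k.+1 < x) phase_length k <= Num.min (run_time N) x.
  by rewrite le_min => /andP[].
elim: N => [|N IH]; first by rewrite big_ord0 le_min lexx.
rewrite big_mkcond big_ord_recr -big_mkcond /=; move: IH; rewrite !le_min run_timeS => /andP[h1 h2].
have := phase_length_ge0 N; case: ltP => h; rewrite ?addr0 ?h2 ?andbT; lra.
Qed.

(* While [v] is alive, at least [rank v] tasks of its job are, where the tasks
   are ranked by decreasing completion phase. *)
Lemma sum_shared_work_le j :
  \sum_(k < ntasks I) phase_length k *
     (\sum_(v in alive_at k | job v == j)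
        rate_at k v / ((num_alive k j)%:R * proc v)) <= 1 + ln (ntasks I)%:R.
Proof.
(* The number of phases during which [v] is alive; since these form an initial segment, [d] orders
   the tasks by completion. *)
pose d v := (\sum_(k < ntasks I) (v \in alive_at k))%N.
pose P := [set v | job v == j]%SET.
have dlt k v w : (k < ntasks I)%N -> v \in alive_at k -> w \notin alive_at k ->
    (d w < d v)%N.
  move=> kn vk wk; rewrite /d (bigD1 (Ordinal kn)) // [X in (_ < X)%N](bigD1 (Ordinal kn)) //=.
  rewrite vk (negbTE wk) add0n add1n ltnS; apply: leq_sum => i _.
  case wi: (w \in alive_at i) => //; rewrite (fintype.subsetP (@alive_at_noninc i k _)) //.
  by rewrite leqNgt; apply/negP => /ltnW/alive_at_noninc/fintype.subsetP/(_ _ wi); apply/negP.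
apply: (@le_trans _ _ (\sum_(v in P) (#|[set w in P | (d v <= d w)%N]%SET|%:R)^-1)); last first.
  apply: le_trans (sum_inv_rank_le R d P) _; rewrite lerD2l.
  have [->|[v vP]] := set_0Vmem P.
    rewrite cards0 ln0 //; case: (ntasks I) => [|n]; first by rewrite ln0.
    by rewrite ln_ge0 // ler1n.
  have P0 : (0 < #|P|)%N by apply/card_gt0P; exists v.
  have Pn : (#|P| <= ntasks I)%N by rewrite (leq_trans (max_card _)) // card_ord.
  by rewrite ler_ln ?posrE ?ltr0n ?ler_nat // (leq_trans P0).
under eq_bigr do rewrite mulr_sumr big_mkcond.
rewrite exchange_big [leRHS]big_mkcond /=; apply: ler_sum => v _.
rewrite inE; case: ifPn => vj; last by rewrite big1 // => k _; rewrite andbF.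
set rk := #|_|%:R; have rk0 : 0 < rk :> R.
  by rewrite ltr0n; apply/card_gt0P; exists v; rewrite !inE vj leqnn.
have [p0|p0] := ltP 0 (proc v); last first.
  rewrite big1 ?invr_ge0 ?ltW // => k _.
  have := fintype.subsetP (@alive_at_noninc 0 k (leq0n _)) v.
  by case: (v \in _) => // /(_ isT); rewrite mem_alive_at ltNge p0.
apply: (@le_trans _ _ (\sum_(k < ntasks I) (phase_length k * rate_at k v) / (rk * proc v))).
  apply: ler_sum => k _; rewrite andbT; case: ifPn => vk; last first.
    by rewrite divr_ge0 ?mulr_ge0 ?phase_length_ge0 ?rate_at_ge0 // ltW.
  rewrite -mulrA ler_wpM2l ?phase_length_ge0 // ler_wpM2l ?rate_at_ge0 //.
  (* Tasks of the job that live at least as long as [v] are all alive in any phase where [v] is. *)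
  have rkn : rk <= (num_alive k j)%:R.
    rewrite ler_nat; apply/subset_leq_card/fintype.subsetP => w.
    rewrite !inE => /andP[-> dw]; rewrite andbT.
    by rewrite -mem_alive_at; apply: contraTT dw => /(dlt k v w (ltn_ord k) vk); rewrite -ltnNge.
  have rkn0 := lt_le_trans rk0 rkn.
  rewrite lef_pV2 ?posrE; [|exact: mulr_gt0|exact: mulr_gt0].
  by rewrite ler_pM2r.
rewrite -mulr_suml invfM mulrCA ger_pMr ?invr_gt0 // ler_pdivrMr // mul1r.
exact: sum_work_le.
Qed.

End Run.

(** * Comparison with an offline schedule *)

Section Competitiveness.
Variables (R : realType) (I : instance R).
Implicit Types (v : 'I_(ntasks I)) (j : 'I_(njobs I)).

Lemma job_time_ge0 j : 0 <= job_time j.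
Proof. by apply: sumr_ge0 => k _; exact: phase_length_ge0. Qed.

Lemma num_alive_gt0 k j : job_alive k j -> (0 < num_alive k j)%N.
Proof. by move=> /existsP[v vk]; apply/card_gt0P; exists v; rewrite inE. Qed.

Lemma sum_unit_rate k : \sum_(v in alive_at I k) unit_rate (alive_at I k) v =
  \sum_(j < njobs I | job_alive k j) weight j.
Proof.
rewrite (partition_big (@job _ I) (job_alive k)) /=; last first.
  by move=> v vk; apply/existsP; exists v; rewrite vk eqxx.
apply: eq_bigr => j kj.
rewrite (eq_bigr (fun=> weight j / (num_alive k j)%:R)); last first.
  by move=> v /andP[_ /eqP vj]; rewrite /unit_rate vj.
rewrite sumr_const (_ : #|_| = num_alive k j) // -[LHS]mulr_natr divfK //.
by rewrite pnatr_eq0 -lt0n num_alive_gt0.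
Qed.

Lemma sum_weighted_job_time : \sum_(j < njobs I) weight j * job_time j =
  \sum_(k < ntasks I) phase_length I k *
    \sum_(v in alive_at I k) unit_rate (alive_at I k) v.
Proof.
under [RHS]eq_bigr do rewrite sum_unit_rate mulr_sumr big_mkcond.
rewrite exchange_big /=; apply: eq_bigr => j _.
rewrite -big_mkcond /= mulr_sumr; apply: eq_bigr => k _; exact: mulrC.
Qed.

(** The phases that end before half of the job time have total length at most that half. *)
Lemma sum_late_phases_ge j :
  job_time j / 2 <= \sum_(k < ntasks I | job_alive k j &&
    (job_time j / 2 <= run_time I k.+1)) phase_length I k.
Proof.
have : \sum_(k < ntasks I | job_alive k j && ~~ (job_time j / 2 <= run_time I k.+1))
    phase_length I k <= job_time j / 2.
  apply: le_trans (@sum_early_phases_le _ I (ntasks I) _ _); last first.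
    by rewrite divr_ge0 // job_time_ge0.
  rewrite big_mkcond [leRHS]big_mkcond; apply: ler_sum => k _.
  by rewrite ltNge; case: (job_alive k j) => //=; case: ifP => // _;
    rewrite phase_length_ge0.
have : job_time j =
    \sum_(k < ntasks I | job_alive k j && (job_time j / 2 <= run_time I k.+1))
      phase_length I k +
    \sum_(k < ntasks I | job_alive k j && ~~ (job_time j / 2 <= run_time I k.+1))
      phase_length I k by exact: bigID.
by move: (\sum_(k < _ | _) _) (\sum_(k < _ | _ && ~~ _) _) => a b; lra.
Qed.

Variable sigma : schedule I.
Hypothesis sigma_feasible : feasible sigma.

Let H : R := 1 + ln (ntasks I)%:R.

Let H_gt0 : 0 < H.
Proof.
rewrite /H; case: (ntasks I) => [|n]; first by rewrite ln0 // addr0.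
by rewrite ltr_wpDr // ln_ge0 // ler1n.
Qed.

Definition offline_time j : \bar R :=
  \big[maxe/0%E]_(v < ntasks I | job v == j) completion sigma v.

Lemma offline_time_ge0 j : (0 <= offline_time j)%E.
Proof. exact: bigmax_ge_id. Qed.

Definition offline_rate (T : R) v : R :=
  if (offline_time (job v) < T%:E)%E then proc v / T else 0.

Lemma offline_rate_ge0 T v : 0 <= T -> 0 <= offline_rate T v.
Proof.
by move=> T0; rewrite /offline_rate; case: ifP => // _; rewrite divr_ge0 // proc_ge0.
Qed.

Lemma offline_rate_within A T : 0 <= T ->
  within_prefix_speeds A (offline_rate T).
Proof.
move=> T0 V _; rewrite /offline_rate -big_mkcondr /=.
rewrite (eq_bigl (mem [set v in V | (offline_time (job v) < T%:E)%E]%SET)); last first.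
  by move=> v; rewrite !inE.
set V' := finset _.
apply: (@le_trans _ _ (prefix_speed I #|V'|)); last first.
  apply/prefix_speed_le/subset_leq_card/fintype.subsetP => v.
  by rewrite inE => /andP[].
(* For horizon 0, division by zero makes every rate 0. *)
rewrite -mulr_suml; move: T0; rewrite le_eqVlt => /predU1P[<-|T0].
  rewrite invr0 mulr0 -(prefix_speed0 I); exact: prefix_speed_le.
rewrite ler_pdivrMr // mulrC; apply: (sum_proc_le sigma_feasible); first exact: ltW.
move=> v; rewrite inE => /andP[_]; apply: le_lt_trans.
by rewrite /offline_time; apply: le_bigmax_cond.
Qed.

Definition delayed j : bool :=
  (0 < weight j) && (offline_time j < (job_time j / (16 * H))%:E)%E.

(** The horizon is read off at the end of the phase and kept constant throughout it, which turns the
    integral over time into a finite sum. *)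
Definition phase_offline_rate k v : R :=
  offline_rate (run_time I k.+1 / (8 * H)) v.

Definition offline_share k j : R := \sum_(v in alive_at I k | job v == j)
  phase_offline_rate k v * (unit_rate (alive_at I k) v / rate_at k v).

Lemma phase_offline_rate_ge0 k v : 0 <= phase_offline_rate k v.
Proof.
apply/offline_rate_ge0/divr_ge0; last by rewrite mulr_ge0 // ltW.
by rewrite run_time_sum; apply: sumr_ge0 => i _; exact: phase_length_ge0.
Qed.

Lemma offline_share_ge0 k j : 0 <= offline_share k j.
Proof.
apply: sumr_ge0 => v _; rewrite mulr_ge0 ?phase_offline_rate_ge0 //.
by rewrite divr_ge0 ?unit_rate_ge0 ?rate_at_ge0.
Qed.

Lemma offline_share_late k j (b : R) : (k < ntasks I)%N -> delayed j -> job_alive k j ->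
  job_time j / 2 <= run_time I k.+1 ->
  8 * H * weight j / job_time j * (2 * b - b ^+ 2 *
    \sum_(v in alive_at I k | job v == j)
      rate_at k v / ((num_alive k j)%:R * proc v)) <= offline_share k j.
Proof.
move=> kn /andP[wj dj] kj late.
set C := job_time j in dj late *; set g := 8 * H * _ / _.
have C0 : 0 < C.
  have := le_lt_trans (offline_time_ge0 j) dj.
  by rewrite lte_fin pmulr_lgt0 // invr_gt0 mulr_gt0.
have g0 : 0 < g by rewrite /g divr_gt0 ?mulr_gt0.
have n0 : 0 < (num_alive k j)%:R :> R by rewrite ltr0n num_alive_gt0.
set n := _%:R in n0 *.
have -> : 2 * b = \sum_(v in alive_at I k | job v == j) (2 * b / n).
  by rewrite sumr_const (_ : #|_| = num_alive k j) // -[RHS]mulr_natr divfK // gt_eqF.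
rewrite mulr_sumr -sumrB mulr_sumr; apply: ler_sum => v /andP[vk /eqP vj].
have Lv : 0 < rate_at k v by apply: rate_gt0 => //; rewrite vj.
have pv : 0 < proc v.
  by have := fintype.subsetP (@alive_at_noninc _ I 0 k (leq0n _)) v vk; rewrite mem_alive_at.
set T := run_time I k.+1 in late *.
have T0 : 0 < T by apply: lt_le_trans late; rewrite divr_gt0.
have TC : T <= C by exact: run_time_le_job_time.
(* In a late phase the horizon T / 8H is at least C / 16H, which exceeds the offline completion time
   of a delayed job. *)
rewrite /phase_offline_rate /offline_rate vj -/T ifT; last first.
  apply: lt_le_trans dj _; rewrite lee_fin.
  have -> : C / (16 * H) = C / 2 / (8 * H) by field; rewrite gt_eqF.
  by rewrite ler_wpM2r // invr_ge0 mulr_ge0 // ltW.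
rewrite /unit_rate vj -/(num_alive k j) -/n.
set L := rate_at k v in Lv *; set p := proc v in pv *.
have sq : 2 * b - b ^+ 2 * (L / p) <= p / L.
  rewrite -subr_ge0.
  have -> : p / L - (2 * b - b ^+ 2 * (L / p)) = L / p * (p / L - b) ^+ 2.
    by field; rewrite !gt_eqF.
  by rewrite mulr_ge0 ?sqr_ge0 // divr_ge0 // ltW.
have -> : g * (2 * b / n - b ^+ 2 * (L / (n * p))) =
    g / n * (2 * b - b ^+ 2 * (L / p)).
  by field; rewrite !gt_eqF.
apply: (@le_trans _ _ (g / n * (p / L))); first by rewrite ler_wpM2l // divr_ge0 ?ltW.
have -> : p / (T / (8 * H)) * (weight j / n / L) =
    (8 * H * weight j / T) / n * (p / L).
  by field; rewrite !gt_eqF.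
apply: ler_wpM2r; first by rewrite divr_ge0 // ltW.
apply: ler_wpM2r; first by rewrite invr_ge0 ltW.
apply: ler_wpM2l; first by rewrite !mulr_ge0 // ltW.
by rewrite lef_pV2.
Qed.

Lemma delayed_job_share j : delayed j ->
  2 * (weight j * job_time j) <=
  \sum_(k < ntasks I) phase_length I k * offline_share k j.
Proof.
move=> dj; have := dj => /andP[wj oj].
have C0 : 0 < job_time j.
  have := le_lt_trans (offline_time_ge0 j) oj.
  by rewrite lte_fin pmulr_lgt0 // invr_gt0 mulr_gt0.
(* This [b] maximizes b C - b^2 H, with value C^2 / 4H; multiplied by [g] it gives 2 w C. *)
pose b := job_time j / (2 * H); pose g := 8 * H * weight j / job_time j.
have g0 : 0 <= g by rewrite /g divr_ge0 ?mulr_ge0 // ltW.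
have b0 : 0 <= b by rewrite /b divr_ge0 ?mulr_ge0 // ltW.
pose late k := job_alive k j && (job_time j / 2 <= run_time I k.+1).
pose X k := \sum_(v in alive_at I k | job v == j)
      rate_at k v / ((num_alive k j)%:R * proc v).
have X0 k : 0 <= X k.
  by apply: sumr_ge0 => v _; rewrite divr_ge0 ?rate_at_ge0 // mulr_ge0 ?proc_ge0.
(* In a phase that is not late the left-hand side is nonpositive; keeping its error term lets the
   harmonic bound be applied over all phases. *)
have phase (k : 'I_(ntasks I)) :
    g * (2 * b * (if late k then phase_length I k else 0)
       - b ^+ 2 * (phase_length I k * X k)) <= phase_length I k * offline_share k j.
  have d0 := @phase_length_ge0 _ I k.
  case: ifPn => [/andP[kj lk]|_].
    have := @offline_share_late k j b (ltn_ord k) dj kj lk; rewrite -/b -/g -/(X k).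
    move=> /(ler_wpM2l d0); apply: le_trans.
    by rewrite le_eqVlt; apply/orP; left; apply/eqP; ring.
  apply: (@le_trans _ _ 0); last by rewrite mulr_ge0 // offline_share_ge0.
  by rewrite mulr0 sub0r mulrN oppr_le0 mulr_ge0 // mulr_ge0 ?sqr_ge0 // mulr_ge0.
apply: le_trans (ler_sum _ (fun k _ => phase k)).
rewrite -mulr_sumr sumrB -!mulr_sumr -big_mkcond /=.
have h1 := sum_late_phases_ge j; have h2 := @sum_shared_work_le _ I j.
rewrite -/H in h2; set S1 := (X in _ <= X) in h1; set S2 := (X in X <= _) in h2.
have -> : 2 * (weight j * job_time j) =
    g * (2 * b * (job_time j / 2) - b ^+ 2 * H).
  by rewrite /g /b; field; rewrite !gt_eqF.
apply: ler_wpM2l => //; apply: lerB; first by rewrite ler_wpM2l // mulr_ge0.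
by rewrite ler_wpM2l // sqr_ge0.
Qed.

(** Twice the delayed cost is at most the total offline share, which proportional fairness, phase by
    phase, bounds by the whole cost. *)
Lemma weighted_job_time_le : \sum_(j < njobs I) weight j * job_time j <=
  2 * \sum_(j < njobs I | ~~ delayed j) weight j * job_time j.
Proof.
suff : 2 * (\sum_(j < njobs I | delayed j) weight j * job_time j) <=
    \sum_(j < njobs I) weight j * job_time j.
  rewrite [X in _ <= X -> X <= _](bigID delayed) /=.
  by move: (\sum_(j < _ | delayed j) _) (\sum_(j < _ | ~~ _) _) => a b; lra.
rewrite [leRHS]sum_weighted_job_time.
apply: (@le_trans _ _ (\sum_(k < ntasks I) phase_length I k * \sum_j offline_share k j)).
  rewrite mulr_sumr; under [leRHS]eq_bigr do rewrite mulr_sumr.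
  rewrite exchange_big big_mkcond /=; apply: ler_sum => j _.
  case: ifP => [/delayed_job_share //|_]; apply: sumr_ge0 => k _.
  by rewrite mulr_ge0 ?phase_length_ge0 ?offline_share_ge0.
apply: ler_sum => k _; rewrite ler_wpM2l ?phase_length_ge0 //.
rewrite /offline_share -(partition_big (@job _ I) xpredT) //.
apply: proportional_fairness => [v|]; first exact: phase_offline_rate_ge0.
apply/offline_rate_within/divr_ge0; last by rewrite mulr_ge0 // ltW.
by rewrite run_time_sum; apply: sumr_ge0 => i _; exact: phase_length_ge0.
Qed.

Lemma alg_cost_le_job_time :
  (alg_cost I <= (\sum_(j < njobs I) weight j * job_time j)%:E)%E.
Proof.
rewrite /alg_cost /objective -sumEFin; apply: lee_sum => j _.
(* A job of weight 0 may never complete, but 0 times infinity is 0. *)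
have := @weight_ge0 _ I j; rewrite le_eqVlt => /predU1P[<-|wj].
  by rewrite mul0e mul0r.
rewrite EFinM; apply: lee_wpmul2l; first by rewrite lee_fin ltW.
apply: bigmax_le => [|v /eqP vj]; first by rewrite lee_fin job_time_ge0.
by rewrite -vj; apply: alg_completion_le; rewrite vj.
Qed.

Lemma alg_cost_le_schedule :
  (alg_cost I <= (32 * (1 + ln (ntasks I)%:R))%:E * objective (completion sigma))%E.
Proof.
apply: (le_trans alg_cost_le_job_time).
have h := weighted_job_time_le; rewrite -lee_fin in h; apply: (le_trans h).
rewrite -/H mulr_sumr -sumEFin /objective ge0_sume_distrr => [|j _]; last first.
  by rewrite mule_ge0 ?lee_fin ?weight_ge0 //; exact: offline_time_ge0.
rewrite big_mkcond /=; apply: lee_sum => j _; rewrite -/(offline_time j).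
have w0 := @weight_ge0 _ I j.
have r0 : (0 <= (32 * H)%:E * ((weight j)%:E * offline_time j))%E.
  rewrite mule_ge0 ?lee_fin ?mulr_ge0 ?mule_ge0 ?lee_fin ?offline_time_ge0 //.
  exact: ltW.
case: ifPn => // nd; move: w0; rewrite le_eqVlt => /predU1P[w0|w0].
  by rewrite -w0 mul0r mulr0; move: r0; rewrite -w0.
move: nd; rewrite /delayed w0 /= -leNgt => oj.
(* The factor 32 is 2, from discarding delayed jobs, times the delay threshold 16. *)
have -> : 2 * (weight j * job_time j) =
    32 * H * (weight j * (job_time j / (16 * H))).
  by field; rewrite gt_eqF.
rewrite EFinM [X in (_ * X)%E]EFinM.
by rewrite !lee_wpmul2l // lee_fin ?mulr_ge0 // ltW.
Qed.

End Competitiveness.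

Theorem theorem3 (R : realType) :
  exists c : R, 0 < c /\
    forall I : instance R,
      (alg_cost I <=
         (c * ((nspeeds I)%:R + ln (ntasks I)%:R))%:E * opt_cost I)%E.
Proof.
exists 32; split => // I.
have h0 : 0 <= ln (ntasks I)%:R :> R.
  case: (ntasks I) => [|n]; first by rewrite ln0.
  by rewrite ln_ge0 // ler1n.
(* Some machine exists, so K >= 1 and K + ln n dominates 1 + ln n. *)
have K0 : (0 < nspeeds I)%N.
  rewrite /nspeeds lt0n size_eq0; apply/eqP => /(congr1 (mem^~ (speed (Ordinal (nmach_gt0 I))))).
  by rewrite /= mem_undup map_f ?mem_enum.
have K1 : 1 <= (nspeeds I)%:R :> R by rewrite ler1n.
have c0 : 0 < 32 * ((nspeeds I)%:R + ln (ntasks I)%:R) :> R.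
  by rewrite mulr_gt0 // (lt_le_trans ltr01) // (le_trans K1) // lerDl.
rewrite /opt_cost -lee_pdivrMl //.
rewrite leNgt; apply/negP => /ereal_inf_lt[_ [sigma fs <-]].
apply/negP; rewrite -leNgt lee_pdivrMl //.
apply: (le_trans (alg_cost_le_schedule fs)); apply: lee_wpmul2r.
  by apply: sume_ge0 => j _; rewrite mule_ge0 ?lee_fin ?weight_ge0 //;
    exact: offline_time_ge0.
by rewrite lee_fin ler_wpM2l // lerD2r.
Qed.
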